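(* Let $m\ge 1$ and let $A,B\in\mathcal B(\mathbb C^m)$ be traceless Hermitian operators. Set $\Delta=A-B$, let $P_+$ (resp. $P_-$) be the orthogonal projector onto the span of the eigenvectors of $\Delta$ with strictly positive (resp. strictly negative) eigenvalues, and let $P_0=I-P_+-P_-$ be the projector onto $\ker\Delta$. Let $d\ge 2$. Then there exists a completely positive trace-preserving (CPTP) map $\lambda:\mathcal B(\mathbb C^m)\to\mathcal B(\mathbb C^d)$ such that $$\|\lambda(A)\|_1-\|\lambda(B)\|_1=\|\lambda(A-B)\|_1=\|A-B\|_1$$ if and only if there exists an operator $E_0$ with $0\le E_0\le P_0$ satisfying $$\operatorname{Tr}(P_+A)+\operatorname{Tr}(E_0A)\;\ge\;\operatorname{Tr}(P_+B)+\operatorname{Tr}(E_0B)\;\ge\;0.$$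
   Context: $\|X\|_1=\operatorname{Tr}\sqrt{X^\dagger X}$ denotes the trace norm. Operator inequalities $0\le E_0\le P_0$ are in the Loewner (positive semidefinite) order. *)

(* Defs.v *)
From HB Require Import structures.
From mathcomp Require Import all_boot all_order all_algebra.
From mathcomp Require Import reals complex mxtens.
From Stdlib Require Import ClassicalEpsilon.
Set Implicit Arguments. Unset Strict Implicit. Unset Printing Implicit Defensive.
Import Order.TTheory GRing.Theory Num.Theory.
Local Open Scope ring_scope.
Local Open Scope complex_scope.
Local Open Scope sesquilinear_scope.

Section Defs.
Variable R : realType.
Local Notation C := (R[i]).

Definition herm n (M : 'M[C]_n) : Prop := M ^t* = M.

Definition psd n (M : 'M[C]_n) : Prop :=
  forall v : 'cV[C]_n, 0 <= (v ^t* *m M *m v) 0 0.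

Definition loewner_le n (A B : 'M[C]_n) : Prop := psd (B - A).

Definition sqrtm n (M : 'M[C]_n) : 'M[C]_n :=
  epsilon (inhabits 0) (fun S : 'M[C]_n => psd S /\ S *m S = M).

Definition trnorm n (X : 'M[C]_n) : C := \tr (sqrtm (X ^t* *m X)).

Definition inspan n (S : 'cV[C]_n -> Prop) (v : 'cV[C]_n) : Prop :=
  exists (k : nat) (vs : 'I_k -> 'cV[C]_n) (cs : 'I_k -> C),
    (forall j, S (vs j)) /\ v = \sum_(j < k) cs j *: vs j.

Definition orth_proj_onto n (P : 'M[C]_n) (S : 'cV[C]_n -> Prop) : Prop :=
  [/\ P *m P = P, P ^t* = P &
      forall v : 'cV[C]_n, (exists w, v = P *m w) <-> inspan S v].

Definition pos_eigvec n (D : 'M[C]_n) (v : 'cV[C]_n) : Prop :=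
  exists a : C, 0 < a /\ D *m v = a *: v.
Definition neg_eigvec n (D : 'M[C]_n) (v : 'cV[C]_n) : Prop :=
  exists a : C, a < 0 /\ D *m v = a *: v.

(* (id_k \otimes f) acting on a k x k block matrix with m x m blocks. *)
Definition ampl k m d (f : 'M[C]_m -> 'M[C]_d) (X : 'M[C]_(k * m)) : 'M[C]_(k * d) :=
  \matrix_(p, q)
    f (\matrix_(a, b) X (mxtens_index ((mxtens_unindex p).1, a))
                        (mxtens_index ((mxtens_unindex q).1, b)))
      (mxtens_unindex p).2 (mxtens_unindex q).2.

Definition completely_positive m d (f : 'M[C]_m -> 'M[C]_d) : Prop :=
  forall (k : nat) (X : 'M[C]_(k * m)), psd X -> psd (@ampl k m d f X).

Definition cptp m d (f : 'M[C]_m -> 'M[C]_d) : Prop :=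
  [/\ linear f, completely_positive f & forall X, \tr (f X) = \tr X].

End Defs.

(* Main.v *)
(* For a traceless Hermitian X and an effect 0 <= E <= 1 one has
   2 Tr(EX) <= ||X||_1, with equality exactly when E fixes the range of the
   positive part of X and kills that of the negative part.
   Given E0, the measure-and-prepare channel of the effect E = P_+ + E0 sends a
   traceless X to Tr(EX) (|0><0| - |1><1|), and E0 (A - B) = 0.
   Conversely, equality in ||lam A||_1 <= ||lam(A - B)||_1 + ||lam B||_1 makes the
   positive spectral projector Q of lam A optimal for both lam(A - B) and lam B;
   then E = lam^*(Q) is optimal for A - B, so that E0 = E - P_+ satisfies
   0 <= E0 <= P_0, and Tr(EB) = Tr(Q lam(B)) >= 0. *)
Require Import Defs.
From HB Require Import structures.
From mathcomp Require Import all_boot all_order all_algebra.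
From mathcomp Require Import reals complex mxtens.
From Stdlib Require Import ClassicalEpsilon.
Import Order.TTheory GRing.Theory Num.Theory.
Local Open Scope ring_scope.
Local Open Scope complex_scope.

Section PositiveMatrices.
Set Implicit Arguments.
Unset Strict Implicit.
Local Open Scope sesquilinear_scope.
Variable R : realType.
Local Notation C := (R[i]).

(** * Adjoints, congruences and Gram matrices *)

Lemma adjmx_mul m n p (A : 'M[C]_(m, n)) (B : 'M[C]_(n, p)) :
  (A *m B) ^t* = B ^t* *m A ^t*.
Proof. by rewrite trmx_mul map_mxM. Qed.

Lemma adjmxB m n (A B : 'M[C]_(m, n)) : (A - B) ^t* = A ^t* - B ^t*.
Proof. by apply/matrixP => i j; rewrite !mxE rmorphB. Qed.

Lemma adjmx1 n : (1%:M : 'M[C]_n) ^t* = 1%:M.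
Proof. by rewrite trmx1 map_mx1. Qed.

Lemma mulmx_col m n p (A : 'M[C]_(m, n)) (B : 'M[C]_(n, p)) j :
  A *m col j B = col j (A *m B).
Proof. by rewrite !colE mulmxA. Qed.

Lemma mxtraceB n (A B : 'M[C]_n) : \tr (A - B) = \tr A - \tr B.
Proof. exact: raddfB. Qed.

Lemma psd0 n : psd (0 : 'M[C]_n).
Proof. by move=> v; rewrite mulmx0 mul0mx mxE. Qed.

Lemma psdD n (A B : 'M[C]_n) : psd A -> psd B -> psd (A + B).
Proof. by move=> pA pB v; rewrite mulmxDr mulmxDl mxE addr_ge0. Qed.

Lemma psdZ n (a : C) (A : 'M[C]_n) : 0 <= a -> psd A -> psd (a *: A).
Proof. by move=> a0 pA v; rewrite -scalemxAr -scalemxAl mxE mulr_ge0. Qed.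

Lemma psd_congr n p (A : 'M[C]_n) (T : 'M[C]_(n, p)) :
  psd A -> psd (T ^t* *m A *m T).
Proof.
by move=> pA v; have := pA (T *m v); rewrite adjmx_mul !mulmxA.
Qed.

Lemma psd_herm_congr n (A T : 'M[C]_n) : herm T -> psd A -> psd (T *m A *m T).
Proof. by move=> hT pA; rewrite -{1}hT; exact: psd_congr. Qed.

Lemma gram_diagE m n (G : 'M[C]_(m, n)) i :
  (G ^t* *m G) i i = \sum_k `|G k i| ^+ 2.
Proof.
by rewrite mxE; apply: eq_bigr => k _; rewrite !mxE mulrC normCK.
Qed.

Lemma psd1 n : psd (1%:M : 'M[C]_n).
Proof.
move=> v; rewrite mulmx1 gram_diagE; apply: sumr_ge0 => k _.
by rewrite exprn_ge0.
Qed.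

Lemma psd_gram m n (G : 'M[C]_(m, n)) : psd (G ^t* *m G).
Proof. by have := psd_congr G (@psd1 m); rewrite mulmx1. Qed.

Lemma gram_tr_ge0 m n (G : 'M[C]_(m, n)) : 0 <= \tr (G ^t* *m G).
Proof.
apply: sumr_ge0 => i _; rewrite gram_diagE; apply: sumr_ge0 => k _.
by rewrite exprn_ge0.
Qed.

Lemma gram_tr_eq0 m n (G : 'M[C]_(m, n)) : \tr (G ^t* *m G) = 0 -> G = 0.
Proof.
have Hk i k : 0 <= `|G k i| ^+ 2 by rewrite exprn_ge0.
move=> /eqP; rewrite /mxtrace psumr_eq0; last first.
  by move=> i _; rewrite gram_diagE sumr_ge0.
move=> /allP H0; apply/matrixP => k i.
have := H0 i; rewrite mem_index_enum gram_diagE => /(_ isT).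
rewrite psumr_eq0 // => /allP /(_ k); rewrite mem_index_enum => /(_ isT).
by rewrite expf_eq0 /= normr_eq0 mxE => /eqP.
Qed.

Lemma gram_eq0 m n (G : 'M[C]_(m, n)) : G ^t* *m G = 0 -> G = 0.
Proof. by move=> G0; apply: gram_tr_eq0; rewrite G0 mxtrace0. Qed.

(** * Unitary diagonalisation and the spectral theorem *)

Definition udiag n (U : 'M[C]_n) (e : 'rV[C]_n) := U ^t* *m diag_mx e *m U.

(** Take [G] = diag(sqrt(e)) U; a real diagonal matrix is its own adjoint. *)
Lemma udiag_gram n (U : 'M[C]_n) (e : 'rV[C]_n) : (forall i, 0 <= e 0 i) ->
  exists G : 'M[C]_n, udiag U e = G ^t* *m G.
Proof.
move=> e0; exists (diag_mx (map_mx sqrtC e) *m U).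
rewrite adjmx_mul mulmxA -[U ^t* *m _ *m _]mulmxA /udiag; congr (_ *m _ *m _).
apply/matrixP => i j; rewrite mul_mx_diag !mxE rmorphMn /=.
rewrite geC0_conj ?sqrtC_ge0 // eq_sym.
by have [->|_] := eqVneq i j; rewrite ?mulr1n ?mulr0n ?mul0r // -expr2 sqrtCK.
Qed.

Lemma psd_udiag n (U : 'M[C]_n) (e : 'rV[C]_n) : (forall i, 0 <= e 0 i) ->
  psd (udiag U e).
Proof. by move=> /(udiag_gram U) [G ->]; exact: psd_gram. Qed.

Lemma udiagM n (U : 'M[C]_n) (e f : 'rV[C]_n) : U \is unitarymx ->
  udiag U e *m udiag U f = udiag U (\row_i (e 0 i * f 0 i)).
Proof.
move=> /unitarymxP UU; rewrite /udiag !mulmxA -[_ *m U *m U ^t*]mulmxA UU mulmx1.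
by rewrite -[U ^t* *m _ *m _]mulmxA mulmx_diag.
Qed.

Lemma udiagB n (U : 'M[C]_n) (e f : 'rV[C]_n) :
  udiag U e - udiag U f = udiag U (e - f).
Proof. by rewrite /udiag linearB mulmxBr mulmxBl. Qed.

Lemma udiag1 n (U : 'M[C]_n) : U \is unitarymx -> udiag U (const_mx 1) = 1%:M.
Proof.
move=> Uu; rewrite /udiag diag_const_mx mulmx1 -invmx_unitary //.
by rewrite mulVmx // unitarymx_unit.
Qed.

Lemma herm_udiag n (U : 'M[C]_n) (e : 'rV[C]_n) : e \is a realmx ->
  herm (udiag U e).
Proof.
move=> eR; rewrite /herm /udiag !adjmx_mul trmxCK mulmxA tr_diag_mx.
by rewrite map_diag_mx (realmxC eR).
Qed.

Lemma normal_spectral n (A : 'M[C]_n) : A \is normalmx ->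
  A = udiag (spectralmx A) (spectral_diag A).
Proof.
by move=> /orthomx_spectralP {1}->; rewrite invmx_unitary // spectral_unitarymx.
Qed.

Lemma hermsymmx_of_herm n (A : 'M[C]_n) : herm A -> A \is hermsymmx.
Proof. by move=> hA; apply/is_hermitianmxP; rewrite expr0 scale1r hA. Qed.

Lemma herm_spectral n (A : 'M[C]_n) : herm A ->
  A = udiag (spectralmx A) (spectral_diag A).
Proof. by move=> /hermsymmx_of_herm /hermitian_normalmx; exact: normal_spectral. Qed.

Lemma herm_spectral_real n (A : 'M[C]_n) i : herm A ->
  spectral_diag A 0 i \is Num.real.
Proof. by move=> /hermsymmx_of_herm /hermitian_spectral_diag_real /mxOverP. Qed.

(** The columns of the adjoint of [U] form the eigenbasis, so eigenvalues are values of the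
    quadratic form; this turns [psd] into nonnegativity of the spectrum. *)
Lemma udiag_quadE n (U : 'M[C]_n) (e : 'rV[C]_n) i : U \is unitarymx ->
  ((col i (U ^t* )) ^t* *m udiag U e *m col i (U ^t* )) 0 0 = e 0 i.
Proof.
move=> /unitarymxP UU; rewrite colE adjmx_mul trmxCK /udiag !mulmxA.
rewrite -[_ *m U *m U ^t*]mulmxA UU mulmx1 -[_ *m U *m U ^t*]mulmxA UU mulmx1.
have -> : (delta_mx i 0 : 'cV[C]_n) ^t* = delta_mx 0 i.
  by rewrite trmx_delta map_delta_mx.
by rewrite -rowE -colE !mxE eqxx mulr1n.
Qed.

(* The anti-Hermitian part is normal with vanishing quadratic form, so all its
   eigenvalues are zero. *)
Lemma psd_herm n (A : 'M[C]_n) : psd A -> herm A.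
Proof.
move=> pA; pose N := A - A ^t*.
have adjN : N ^t* = - N by rewrite adjmxB trmxCK opprB.
have NN : N \is normalmx by apply/normalmxP; rewrite adjN mulmxN mulNmx.
have N0 (v : 'cV[C]_n) : (v ^t* *m N *m v) 0 0 = 0.
  have -> : v ^t* *m N *m v = v ^t* *m A *m v - (v ^t* *m A *m v) ^t*.
    by rewrite !adjmx_mul trmxCK mulmxBr mulmxBl !mulmxA.
  by move: (pA v); move: (_ *m v) => q q0; rewrite !mxE geC0_conj ?subrr.
have d0 : spectral_diag N = 0.
  apply/rowP => i; rewrite -(udiag_quadE _ _ (spectral_unitarymx N)).
  by rewrite -normal_spectral // N0 mxE.
apply/eqP; rewrite eq_sym -subr_eq0 -/N (normal_spectral NN) d0.
by rewrite /udiag linear0 mulmx0 mul0mx.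
Qed.

(** * Factorisation of positive matrices and traces of their products *)

Lemma psd_factor n (A : 'M[C]_n) : psd A -> exists G : 'M[C]_n, A = G ^t* *m G.
Proof.
move=> pA; have hA := psd_herm pA; rewrite (herm_spectral hA).
apply: udiag_gram => i; rewrite -(udiag_quadE _ _ (spectral_unitarymx A)).
by rewrite -herm_spectral.
Qed.

(** For A = G^* G and B = H^* H, cyclicity gives K = G H^*, and A B = G^* K H vanishes with K. *)
Lemma psd_mul_tr n (A B : 'M[C]_n) : psd A -> psd B ->
  exists2 K : 'M[C]_n, \tr (A *m B) = \tr (K ^t* *m K) & (K = 0 -> A *m B = 0).
Proof.
move=> /psd_factor [G ->] /psd_factor [H ->]; exists (G *m H ^t*).
  by rewrite adjmx_mul trmxCK mulmxA mxtrace_mulC !mulmxA.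
by move=> K0; rewrite mulmxA -[_ *m G *m _]mulmxA K0 mulmx0 mul0mx.
Qed.

Lemma psd_mul_tr_ge0 n (A B : 'M[C]_n) : psd A -> psd B -> 0 <= \tr (A *m B).
Proof. by move=> pA /(psd_mul_tr pA) [K -> _]; exact: gram_tr_ge0. Qed.

Lemma psd_mul_tr_eq0 n (A B : 'M[C]_n) : psd A -> psd B ->
  \tr (A *m B) = 0 -> A *m B = 0.
Proof. by move=> pA /(psd_mul_tr pA) [K -> h] /gram_tr_eq0. Qed.

Lemma psd_tr_eq0 n (A : 'M[C]_n) : psd A -> \tr A = 0 -> A = 0.
Proof. by move=> /psd_factor [G ->] /gram_tr_eq0 ->; rewrite mulmx0. Qed.

Lemma psd_tr_ge0 n (A : 'M[C]_n) : psd A -> 0 <= \tr A.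
Proof. by move=> /psd_factor [G ->]; exact: gram_tr_ge0. Qed.

(* With D = S - T, cyclicity of the trace gives tr (D (S + T) D) = 0, hence
   D S D = D T D = 0 and D ^ 3 = 0. *)
Lemma psd_sqrt_unique n (S T : 'M[C]_n) :
  psd S -> psd T -> S *m S = T *m T -> S = T.
Proof.
move=> pS pT eST; pose D := S - T.
have hD : D ^t* = D by rewrite /D adjmxB (psd_herm pS) (psd_herm pT).
have pDS : psd (D *m S *m D) by exact: psd_herm_congr.
have pDT : psd (D *m T *m D) by exact: psd_herm_congr.
have tr0 : \tr (D *m S *m D) + \tr (D *m T *m D) = 0.
  rewrite -mxtraceD -mulmxDl -mulmxDr mxtrace_mulC mulmxA.
  have -> : D *m D *m (S + T) = D *m (S *m T - T *m S).
    rewrite -mulmxA; congr (_ *m _); rewrite /D mulmxBl !mulmxDr eST.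
    by rewrite opprD addrACA addrC addrA subrK.
  rewrite /D mulmxBl !mulmxBr !mulmxA eST -[T *m S *m T]mulmxA.
  have e1 : \tr (T *m (S *m T)) = \tr (S *m T *m T) by rewrite mxtrace_mulC.
  have e2 : \tr (S *m T *m S) = \tr (T *m T *m T).
    by rewrite mxtrace_mulC mulmxA eST.
  have e3 : \tr (T *m T *m S) = \tr (S *m T *m T) by rewrite mxtrace_mulC mulmxA.
  have cancel (x y z u : C) : y = x -> z = u -> x - y - (z - u) = 0.
    by move=> -> ->; rewrite !subrr.
  rewrite 3!mxtraceB; exact: cancel e2 (etrans e1 (esym e3)).
move/eqP: tr0; rewrite paddr_eq0 ?psd_tr_ge0 // => /andP [/eqP t1 /eqP t2].
have D3 : D *m D *m D = 0.
  have -> : D *m D *m D = D *m S *m D - D *m T *m D by rewrite -mulmxBl -mulmxBr.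
  by rewrite (psd_tr_eq0 pDS t1) (psd_tr_eq0 pDT t2) subrr.
(* D^2 is Hermitian with square D^4 = 0, so D^2 = 0; the same argument then gives D = 0. *)
have DD : D *m D = 0.
  by apply: gram_eq0; rewrite adjmx_mul hD mulmxA D3 mul0mx.
by apply/eqP; rewrite -subr_eq0 -/D; apply/eqP/gram_eq0; rewrite hD.
Qed.

Lemma psd_proj n (P : 'M[C]_n) : P *m P = P -> herm P -> psd P.
Proof. by move=> PP hP; rewrite -PP -{1}hP; exact: psd_gram. Qed.

Lemma herm_sub n (A B : 'M[C]_n) : herm A -> herm B -> herm (A - B).
Proof. by move=> hA hB; rewrite /herm adjmxB hA hB. Qed.

(** Selecting rows and columns by [h] is congruence by the 0/1 matrix that sends e_j to e_(h j). *)
Lemma psd_mxsub n p (h : 'I_p -> 'I_n) (A : 'M[C]_n) : psd A -> psd (mxsub h h A).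
Proof.
move=> pA; pose T : 'M[C]_(n, p) := \matrix_(i, j) (i == h j)%:R.
suff -> : mxsub h h A = T ^t* *m A *m T by exact: psd_congr.
apply/matrixP => i j; rewrite !mxE (bigD1 (h j)) //= big1 ?addr0; last first.
  by move=> k /negbTE kj; rewrite [T _ _]mxE kj mulr0.
rewrite [T _ _]mxE eqxx mulr1 mxE (bigD1 (h i)) //= big1 ?addr0.
  by rewrite !mxE eqxx conjC1 mul1r.
by move=> k /negbTE ki; rewrite !mxE ki conjC0 mul0r.
Qed.

(** 0 <= Tr(EM) <= Tr(PM) = 0, and a product of two positive matrices with zero trace vanishes. *)
Lemma psd_mul_eq0_le n (E P M : 'M[C]_n) :
  psd E -> psd (P - E) -> psd M -> P *m M = 0 -> E *m M = 0.
Proof.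
move=> pE pPE pM PM0; apply: psd_mul_tr_eq0 => //; apply/le_anti.
rewrite psd_mul_tr_ge0 // andbT -oppr_ge0.
by have := psd_mul_tr_ge0 pPE pM; rewrite mulmxBl PM0 sub0r raddfN.
Qed.

(** * Jordan decomposition and the trace norm *)

(** For Hermitian [X], [P *m X] and [(P - 1%:M) *m X] are its positive and negative parts, and [X]
    is their difference. How [P] cuts the kernel of [X] is left free. *)
Definition jordan_proj n (P X : 'M[C]_n) : Prop :=
  [/\ P *m P = P, herm P, P *m X = X *m P, psd (P *m X)
    & psd ((P - 1%:M) *m X)].

(** Q = 2P - 1 is an involution commuting with X, so QX is positive with square X^* X; uniqueness of
    the positive square root identifies it with the chosen [sqrtm]. *)
Lemma trnormE n (P X : 'M[C]_n) : herm X -> jordan_proj P X ->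
  trnorm X = \tr (P *m X) + \tr ((P - 1%:M) *m X).
Proof.
move=> hX [PP hP PX p1 p2]; pose Q := P + (P - 1%:M).
have QQ : Q *m Q = 1%:M.
  have P1 : P *m (P - 1%:M) = 0 by rewrite mulmxBr mulmx1 PP subrr.
  have P1' : (P - 1%:M) *m P = 0 by rewrite mulmxBl mul1mx PP subrr.
  rewrite /Q mulmxDl (mulmxDr P) (mulmxDr (P - _)) PP P1 P1' addr0 add0r mulmxBr mulmx1 P1'.
  by rewrite sub0r opprB addrC subrK.
have QX : Q *m X = X *m Q by rewrite /Q mulmxDl mulmxDr mulmxBl mulmxBr mulmx1 mul1mx PX.
have QXQX : (Q *m X) *m (Q *m X) = X ^t* *m X.
  by rewrite hX {1}QX mulmxA -[X *m Q *m Q]mulmxA QQ mulmx1.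
have pQX : psd (Q *m X) by rewrite mulmxDl; exact: psdD.
have [pS SS] : psd (sqrtm (X ^t* *m X)) /\
    sqrtm (X ^t* *m X) *m sqrtm (X ^t* *m X) = X ^t* *m X.
  exact: (epsilon_spec _ (fun S => psd S /\ S *m S = X ^t* *m X)
    (ex_intro _ (Q *m X) (conj pQX QXQX))).
rewrite -mxtraceD -mulmxDl /trnorm; congr (\tr _).
by apply: (psd_sqrt_unique pS pQX); rewrite SS QXQX.
Qed.

Lemma trnorm_traceless n (P X : 'M[C]_n) :
  herm X -> \tr X = 0 -> jordan_proj P X -> trnorm X = \tr (P *m X) *+ 2.
Proof.
move=> hX X0 jP; rewrite (trnormE hX jP) mulmxBl mul1mx mxtraceB X0 subr0.
by rewrite mulr2n.
Qed.

(** For 0 <= E <= 1 and a Jordan projector [P], both terms on the right are traces of products of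
    positive matrices: this gives optimality of [P], and in the equality case both products
    vanish. *)
Lemma tr_jordan_subE n (P X E : 'M[C]_n) :
  \tr (P *m X) - \tr (E *m X) =
  \tr ((1%:M - E) *m (P *m X)) + \tr (E *m ((P - 1%:M) *m X)).
Proof.
rewrite -mxtraceB -mxtraceD; congr (\tr _).
by rewrite !mulmxBl mulmxBr !mul1mx addrA subrK.
Qed.

Lemma tr_jordan_le n (P X E : 'M[C]_n) : jordan_proj P X ->
  psd E -> psd (1%:M - E) -> \tr (E *m X) <= \tr (P *m X).
Proof.
move=> [_ _ _ p1 p2] pE pE'.
by rewrite -subr_ge0 tr_jordan_subE addr_ge0 ?psd_mul_tr_ge0.
Qed.

Lemma tr_jordan_eq n (P X E : 'M[C]_n) : jordan_proj P X ->
  psd E -> psd (1%:M - E) -> \tr (E *m X) = \tr (P *m X) ->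
  (1%:M - E) *m (P *m X) = 0 /\ E *m ((P - 1%:M) *m X) = 0.
Proof.
move=> [_ _ _ p1 p2] pE pE' eqE.
have /eqP := tr_jordan_subE P X E; rewrite eqE subrr eq_sym.
rewrite paddr_eq0 ?psd_mul_tr_ge0 // => /andP [/eqP t1 /eqP t2].
by split; apply: psd_mul_tr_eq0.
Qed.

(** * Spectral projectors *)

(** Each projector fixes the range of the other, so PQ = Q and QP = P; taking adjoints gives P =
    Q. *)
Lemma orth_proj_unique n (P Q : 'M[C]_n) (S : 'cV[C]_n -> Prop) :
  orth_proj_onto P S -> orth_proj_onto Q S -> P = Q.
Proof.
have absorb (P1 P2 : 'M[C]_n) : orth_proj_onto P1 S -> orth_proj_onto P2 S ->
    P1 *m P2 = P2.
  move=> [P11 _ r1] [_ _ r2]; apply/matrixP => i j.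
  suff /colP/(_ i) : P1 *m col j P2 = col j P2 by rewrite mulmx_col [LHS]mxE [RHS]mxE.
  have /r2 /r1 [w ->] : exists w, col j P2 = P2 *m w.
    by exists (delta_mx j 0); rewrite colE.
  by rewrite mulmxA P11.
move=> oP oQ; have [_ hP _] := oP; have [_ hQ _] := oQ.
by rewrite -hP -(absorb _ _ oQ oP) adjmx_mul hP hQ (absorb _ _ oP oQ).
Qed.

Definition specproj n (X : 'M[C]_n) (p : pred C) : 'M[C]_n :=
  udiag (spectralmx X) (\row_i (p (spectral_diag X 0 i))%:R).

(** In the eigenbasis (d_i - a) u_i = 0, so the coordinates of [v] are supported where d_i = a, and
    there [p] holds. *)
Lemma specproj_eigenvector n (X : 'M[C]_n) (p : pred C) (v : 'cV[C]_n) a :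
  herm X -> p a -> X *m v = a *: v -> specproj X p *m v = v.
Proof.
move=> hX pa; rewrite {1}(herm_spectral hX) /specproj /udiag.
set U := spectralmx X; set d := spectral_diag X.
have Uu : U \is unitarymx by exact: spectral_unitarymx.
have UU : U *m U ^t* = 1%:M by apply/unitarymxP.
have UU' : U ^t* *m U = 1%:M.
  by rewrite -invmx_unitary // mulVmx // unitarymx_unit.
move=> /(congr1 (mulmx U)); rewrite !mulmxA UU mul1mx -scalemxAr -!mulmxA.
move=> eu; suff eb : diag_mx (\row_i (p (d 0 i))%:R) *m (U *m v) = U *m v.
  by rewrite eb mulmxA UU' mul1mx.
move: (U *m v) eu => u eu; apply/matrixP => i j; have := congr1 (fun M : 'cV[C]_n => M i j) eu.
rewrite !mul_diag_mx !mxE => /eqP; have [-> _|da] := eqVneq (d 0 i) a.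
  by rewrite pa mul1r.
by rewrite -subr_eq0 -mulrBl mulf_eq0 subr_eq0 (negbTE da) => /eqP ->; rewrite mulr0.
Qed.

Lemma specproj_orth_proj n (X : 'M[C]_n) (p : pred C) a0 : herm X -> p a0 ->
  orth_proj_onto (specproj X p) (fun v => exists a, p a /\ X *m v = a *: v).
Proof.
move=> hX pa0; have Uu := spectral_unitarymx X.
split.
- rewrite /specproj (udiagM _ _ Uu); congr udiag; apply/rowP => i.
  by rewrite !mxE; case: (p _); rewrite ?mulr1 ?mulr0.
- by apply: herm_udiag; apply/mxOverP => i j; rewrite mxE realn.
move=> v; split=> [[w ->]|[k [vs [cs [Hvs ->]]]]].
  pose U := spectralmx X; pose d := spectral_diag X.
  have XU : X *m U ^t* = U ^t* *m diag_mx d.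
    rewrite {1}(herm_spectral hX) /udiag -/U -/d -!mulmxA.
    by have /unitarymxP -> : U \is unitarymx; rewrite ?mulmx1.
  (* Indices rejected by [p] are padded with the zero vector, which belongs to the spanning set with
     eigenvalue [a0]. *)
  exists n, (fun j => if p (d 0 j) then col j (U ^t* ) else 0).
  exists (fun j => (U *m w) j 0); split=> [j|].
    case: ifP => pj; last by exists a0; rewrite mulmx0 scaler0.
    exists (d 0 j); split=> //; rewrite mulmx_col XU.
    by apply/matrixP => i l; rewrite mxE mul_mx_diag !mxE mulrC.
  rewrite /specproj /udiag -/U -(mulmxA _ U w); move: (U *m w) => u.
  apply/matrixP => i l; rewrite mxE summxE; apply: eq_bigr => j _.
  rewrite mul_mx_diag ord1 !mxE -/U -/d; case: (p _); rewrite !mxE.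
    by rewrite mulr1 mulrC.
  by rewrite !mulr0 mul0r.
exists (\sum_(j < k) cs j *: vs j); rewrite mulmx_sumr; apply: eq_bigr => j _.
by have [a [pa Xv]] := Hvs j; rewrite -scalemxAr (specproj_eigenvector hX pa Xv).
Qed.

Lemma udiag0 n (U : 'M[C]_n) : udiag U 0 = 0.
Proof. by rewrite /udiag linear0 mulmx0 mul0mx. Qed.

Lemma specproj_jordan n (X : 'M[C]_n) : herm X ->
  jordan_proj (specproj X (fun a => 0 < a)) X.
Proof.
move=> hX; have lt01 : (0 : C) < 1 by exact: ltr01.
have [PP hP _] := specproj_orth_proj (p := fun a => 0 < a) hX lt01.
split=> {PP hP}//; rewrite /specproj;
  move: (herm_spectral hX) (spectral_unitarymx X)
    (fun i => herm_spectral_real i hX);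
  move: (spectralmx X) (spectral_diag X) => U d -> Uu dR.
- by rewrite !(udiagM _ _ Uu); congr udiag; apply/rowP => i; rewrite !mxE mulrC.
- rewrite (udiagM _ _ Uu); apply: psd_udiag => i; rewrite !mxE.
  by case: (real_ltP (real0 _) (dR i)) => [/ltW|]; rewrite ?mul1r ?mul0r.
- rewrite -(udiag1 Uu) udiagB (udiagM _ _ Uu); apply: psd_udiag => i; rewrite !mxE.
  case: (real_ltP (real0 _) (dR i)) => [_|]; first by rewrite subrr mul0r.
  by rewrite sub0r mulN1r oppr_ge0.
Qed.

(** Factoring [Pp] and [Pm] through the positive and negative parts of [X] makes any matrix that
    kills such a part from the left kill the projector too. *)
Lemma signed_projectors n (X Pp Pm : 'M[C]_n) : herm X ->
  orth_proj_onto Pp (pos_eigvec X) -> orth_proj_onto Pm (neg_eigvec X) ->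
  [/\ jordan_proj Pp X, exists Y, Pp = (Pp *m X) *m Y,
      exists Z, Pm = ((Pp - 1%:M) *m X) *m Z,
      Pm *m Pp = 0 & (1%:M - Pp - Pm) *m X = 0].
Proof.
move=> hX oPp oPm; have lt01 : (0 : C) < 1 by exact: ltr01.
have ltN10 : (-1 : C) < 0 by rewrite oppr_lt0.
rewrite (orth_proj_unique oPp (specproj_orth_proj (p := fun a => 0 < a) hX lt01)).
rewrite (orth_proj_unique oPm (specproj_orth_proj (p := fun a => a < 0) hX ltN10)).
split; first exact: specproj_jordan.
all: rewrite /specproj; move: (herm_spectral hX) (spectral_unitarymx X)
    (fun i => herm_spectral_real i hX).
all: move: (spectralmx X) (spectral_diag X) => U d XE Uu dR; rewrite ?XE.
(* The pseudo-inverse of [X]; where an eigenvalue is 0, so is the entry of [Pp *m X]. *)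
- exists (udiag U (\row_i (d 0 i)^-1)); rewrite !(udiagM _ _ Uu); congr udiag.
  apply/rowP => i; rewrite !mxE.
  case: (real_ltgtP (dR i) (real0 _)) => [_|d0|->]; rewrite ?mul0r //.
  by rewrite mul1r mulfV // gt_eqF.
(* The sign compensates for the factor -1 that Pp - 1 contributes on negative eigenvalues. *)
- exists (udiag U (\row_i - (d 0 i)^-1)); rewrite -(udiag1 Uu) udiagB !(udiagM _ _ Uu).
  congr udiag; apply/rowP => i; rewrite !mxE.
  case: (real_ltgtP (dR i) (real0 _)) => [d0|_|->]; rewrite ?subrr ?mulr0 ?mul0r //.
  by rewrite sub0r mulN1r mulrNN mulfV // lt_eqF.
- rewrite (udiagM _ _ Uu) -(udiag0 U); congr udiag; apply/rowP => i; rewrite !mxE.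
  by case: (real_ltgtP (dR i) (real0 _)); rewrite ?mul0r ?mulr0.
- rewrite -(udiag1 Uu) !udiagB (udiagM _ _ Uu) -(udiag0 U); congr udiag.
  apply/rowP => i; rewrite !mxE.
  case: (real_ltgtP (dR i) (real0 _)) => [_|_|->]; rewrite ?mulr0 //.
    by rewrite subr0 subrr mul0r.
  by rewrite subrr subr0 mul0r.
Qed.

(* Equality in the triangle inequality forces the positive spectral projector of
   A to be optimal for both A - B and B. *)
Lemma trnorm_split_effect n (A B : 'M[C]_n) :
  herm A -> herm B -> \tr A = 0 -> \tr B = 0 ->
  trnorm A - trnorm B = trnorm (A - B) ->
  exists P : 'M[C]_n, [/\ psd P, psd (1%:M - P),
    \tr (P *m (A - B)) *+ 2 = trnorm (A - B) & 0 <= \tr (P *m B)].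
Proof.
move=> hA hB tA tB.
have hD := herm_sub hA hB.
have tD : \tr (A - B) = 0 by rewrite mxtraceB tA tB subrr.
have jA := specproj_jordan hA; have jB := specproj_jordan hB.
have jD := specproj_jordan hD.
rewrite (trnorm_traceless hA tA jA) (trnorm_traceless hB tB jB).
rewrite (trnorm_traceless hD tD jD).
move: (specproj A _) jA => P [PP hP _ _ _].
move: (specproj B _) jB => Q jB; move: (specproj _ _) jD => S jD.
have pP := psd_proj PP hP.
have pP' : psd (1%:M - P).
  apply: psd_proj; last by apply: herm_sub hP; exact: adjmx1.
  by rewrite mulmxBr mulmx1 mulmxBl mul1mx PP subrr subr0.
have leB := tr_jordan_le jB pP pP'; have leD := tr_jordan_le jD pP pP'.
rewrite -mulrnBl => /eqP; rewrite eqrMn2r //= => /eqP e.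
(* These are the optimality gaps of [P] for B and for A - B. As Tr(PA) = Tr(P(A - B)) + Tr(PB), the
   hypothesis makes them cancel; both are nonnegative, so each is zero. *)
have : (\tr (Q *m B) - \tr (P *m B)) + (\tr (S *m (A - B)) - \tr (P *m (A - B))) == 0.
  have ePA : \tr (P *m A) = \tr (P *m (A - B)) + \tr (P *m B).
    by rewrite -mxtraceD -mulmxDr subrK.
  rewrite addrACA -e ePA [X in X + _]addrC subrK -opprD.
  by rewrite [X in _ - X]addrC subrr.
rewrite paddr_eq0 ?subr_ge0 // !subr_eq0 => /andP [/eqP eB /eqP eD].
exists P; split=> //; first by rewrite eD.
by rewrite -eB; case: jB => _ _ _ /psd_tr_ge0.
Qed.

(** * Trace norm of a difference of two basis projectors *)

Lemma mxtrace_delta n (i : 'I_n) : \tr (delta_mx i i : 'M[C]_n) = 1.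
Proof.
rewrite /mxtrace (bigD1 i) //= big1 ?addr0; first by rewrite mxE !eqxx.
by move=> k /negbTE ki; rewrite mxE ki.
Qed.

Lemma psd_delta n (i : 'I_n) : psd (delta_mx i i : 'M[C]_n).
Proof.
apply: psd_proj; first by rewrite mul_delta_mx.
by rewrite /herm trmx_delta map_delta_mx.
Qed.

(** The projector onto e_i is a Jordan projector for the difference, also when t = 0. *)
Lemma trnorm_delta_sub n (i j : 'I_n) (t : C) : i != j -> 0 <= t ->
  trnorm (t *: (delta_mx i i - delta_mx j j : 'M[C]_n)) = t *+ 2.
Proof.
move=> ij t0; set M := t *: _; have pi := psd_delta i; have pj := psd_delta j.
have ii : (delta_mx i i : 'M[C]_n) *m delta_mx i i = delta_mx i i by rewrite mul_delta_mx.
have iM : delta_mx i i *m M = t *: delta_mx i i.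
  by rewrite -scalemxAr mulmxBr ii mul_delta_mx_0 // subr0.
have Mi : M *m delta_mx i i = t *: delta_mx i i.
  by rewrite -scalemxAl mulmxBl ii mul_delta_mx_0 1?eq_sym // subr0.
have jM : jordan_proj (delta_mx i i) M.
  split; [exact: ii|exact: psd_herm pi|by rewrite iM Mi|by rewrite iM; exact: psdZ|].
  rewrite mulmxBl mul1mx iM -scalerBr opprB addrC subrK.
  exact: psdZ t0 pj.
have hM : herm M.
  rewrite /M scalerBr.
  exact: herm_sub (psd_herm (psdZ t0 pi)) (psd_herm (psdZ t0 pj)).
have tM : \tr M = 0 by rewrite mxtraceZ mxtraceB !mxtrace_delta subrr mulr0.
by rewrite (trnorm_traceless hM tM jM) iM mxtraceZ mxtrace_delta mulr1.
Qed.

End PositiveMatrices.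

Section Channels.
Set Implicit Arguments.
Unset Strict Implicit.
Local Open Scope sesquilinear_scope.
Variable R : realType.
Local Notation C := (R[i]).

(** * Completely positive maps and Kraus forms *)

Lemma sum_mxtens k m (F : 'I_(k * m) -> C) :
  \sum_r F r = \sum_i \sum_a F (mxtens_index (i, a)).
Proof.
rewrite pair_big (reindex (@mxtens_index k m)) /=; last first.
  by exists (@mxtens_unindex k m) => x _; rewrite ?mxtens_indexK ?mxtens_unindexK.
by apply: eq_bigr => -[].
Qed.

(** Turns complete positivity of a conjugation into a plain congruence; the identity factor
    collapses the sums over block indices. *)
Lemma ampl_kraus k m d (K : 'M[C]_(d, m)) (X : 'M[C]_(k * m)) :
  ampl (fun Y => K *m Y *m K ^t* ) X =
  ((1%:M : 'M_k) *t K) *m X *m ((1%:M : 'M_k) *t K) ^t*.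
Proof.
apply/matrixP => p q; case: (mxtens_indexP p) => i a; case: (mxtens_indexP q) => j b.
rewrite 3!mxE sum_mxtens !mxtens_indexK /= (bigD1 j) //= [X in _ = _ + X]big1 ?addr0.
  apply: eq_bigr => c _; rewrite !mxE.
  rewrite !mxtens_indexK eqxx mul1r; congr (_ * _).
  rewrite sum_mxtens (bigD1 i) //= [X in _ = _ + X]big1 ?addr0.
    by apply: eq_bigr => e _; rewrite !mxE !mxtens_indexK eqxx mul1r.
  move=> l /negbTE li; apply: big1 => e _.
  by rewrite !mxE !mxtens_indexK eq_sym li !mul0r.
move=> l /negbTE lj; apply: big1 => c _.
by rewrite !mxE !mxtens_indexK eq_sym lj mul0r conjC0 mulr0.
Qed.

Lemma cp_kraus m d (K : 'M[C]_(d, m)) :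
  completely_positive (fun X => K *m X *m K ^t* ).
Proof.
move=> k X pX; rewrite ampl_kraus.
by have := psd_congr (((1%:M : 'M_k) *t K) ^t* ) pX; rewrite trmxCK.
Qed.

Lemma eq_cp m d (f g : 'M[C]_m -> 'M[C]_d) :
  f =1 g -> completely_positive f -> completely_positive g.
Proof.
move=> fg cf k X /cf; suff -> : ampl f X = ampl g X by [].
by apply/matrixP => p q; rewrite !mxE fg.
Qed.

Lemma cp_add m d (f g : 'M[C]_m -> 'M[C]_d) :
  completely_positive f -> completely_positive g ->
  completely_positive (fun X => f X + g X).
Proof.
move=> cf cg k X pX.
have -> : ampl (fun Y => f Y + g Y) X = ampl f X + ampl g X.
  by apply/matrixP => p q; rewrite !mxE.
by apply: psdD; [exact: cf|exact: cg].
Qed.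

Lemma cp_sum (I : Type) m d (s : seq I) (f : I -> 'M[C]_m -> 'M[C]_d) :
  (forall c, completely_positive (f c)) ->
  completely_positive (fun X => \sum_(c <- s) f c X).
Proof.
move=> cf; elim: s => [|c s IHs].
  move=> k X _; suff -> : ampl (fun Y => \sum_(c <- [::]) f c Y) X = 0 by exact: psd0.
  by apply/matrixP => p q; rewrite !mxE big_nil mxE.
by apply: eq_cp (cp_add (cf c) IHs) => X; rewrite big_cons.
Qed.

(* If E = G^* G, the Kraus operators are |i><c| G for c ranging over the basis. *)
Lemma cp_measure m d (E : 'M[C]_m) (i : 'I_d) : psd E ->
  completely_positive (fun X => \tr (E *m X) *: (delta_mx i i : 'M[C]_d)).
Proof.
move=> /psd_factor [G ->].
apply: (eq_cp _ (cp_sum (index_enum _) (fun c => cp_kraus (delta_mx i c *m G)))) => X.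
rewrite -mulmxA mxtrace_mulC /mxtrace scaler_suml; apply: eq_bigr => c _.
have dE : (delta_mx i c : 'M[C]_(d, m)) ^t* = delta_mx c i.
  by rewrite trmx_delta map_delta_mx.
rewrite adjmx_mul dE !mulmxA -[_ *m G *m X]mulmxA -(mulmxA _ _ (G ^t* )).
move: (_ *m G ^t* ) => M; apply/matrixP => p q.
rewrite mxE (bigD1 c) //= big1 ?addr0 => [|k /negbTE kc]; last first.
  by rewrite [X in _ * X]mxE kc mulr0.
rewrite mxE (bigD1 c) //= big1 ?addr0 => [|k /negbTE kc]; last first.
  by rewrite mxE kc andbF mul0r.
by rewrite !mxE !eqxx andbT /= -mulnb natrM mulrAC mulrC.
Qed.

(** * Positivity and duals of channels *)

(** The case k = 1 of complete positivity, transported along the identification of ['I_(1 * m)] with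
    ['I_m]. *)
Lemma cp_positive m d (f : 'M[C]_m -> 'M[C]_d) (X : 'M[C]_m) :
  completely_positive f -> psd X -> psd (f X).
Proof.
move=> cf pX.
pose h (p : 'I_(1 * m)) := (mxtens_unindex p).2.
have := psd_mxsub (fun a => mxtens_index (0, a)) (cf 1%N _ (psd_mxsub h pX)).
set Y := mxsub _ _ _; suff -> : Y = f X by [].
apply/matrixP => a b; rewrite !mxE !mxtens_indexK /=; congr (f _ _ _).
by apply/matrixP => u v; rewrite !mxE /h !mxtens_indexK.
Qed.

Lemma positive_herm m d (f : 'M[C]_m -> 'M[C]_d) (X : 'M[C]_m) :
  linear f -> completely_positive f -> herm X -> herm (f X).
Proof.
move=> lf cf hX; have [_ _ _ p1 p2] := specproj_jordan hX.
set P := specproj _ _ in p1 p2.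
have fB Y Z : f (Y - Z) = f Y - f Z.
  by rewrite -[Y - Z]addrC -scaleN1r lf scaleN1r addrC.
have -> : X = P *m X - (P - 1%:M) *m X by rewrite -mulmxBl opprB addrC subrK mul1mx.
rewrite fB /herm adjmxB.
by rewrite (psd_herm (cp_positive cf p1)) (psd_herm (cp_positive cf p2)).
Qed.

Lemma linear_dual m d (f : 'M[C]_m -> 'M[C]_d) (G : 'M[C]_d) : linear f ->
  exists E : 'M[C]_m, forall X, \tr (E *m X) = \tr (G *m f X).
Proof.
move=> lf.
pose fL : {linear 'M[C]_m -> 'M[C]_d} :=
  HB.pack f (GRing.isLinear.Build _ _ _ _ f lf).
have fE X : f X = fL X by [].
(* The entries are forced by testing on matrix units: Tr(E e_ji) = E_ij, hence the swapped
   indices. *)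
exists (\matrix_(i, j) \tr (G *m f (delta_mx j i))) => X.
have -> : f X = \sum_j \sum_i X j i *: f (delta_mx j i).
  rewrite fE {1}[X]matrix_sum_delta linear_sum; apply: eq_bigr => j _.
  by rewrite linear_sum; apply: eq_bigr => i _; rewrite linearZ.
rewrite mulmx_sumr raddf_sum /= [LHS]/mxtrace.
under [LHS]eq_bigr do rewrite mxE.
rewrite exchange_big; apply: eq_bigr => j _ /=.
rewrite mulmx_sumr raddf_sum; apply: eq_bigr => i _ /=.
by rewrite -scalemxAr mxtraceZ mxE mulrC.
Qed.

(** The quadratic form of [E] at v is the trace of [E] against the positive matrix v v^*, whose
    image under [f] is positive. *)
Lemma psd_dual m d (f : 'M[C]_m -> 'M[C]_d) (G : 'M[C]_d) (E : 'M[C]_m) :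
  completely_positive f -> psd G ->
  (forall X, \tr (E *m X) = \tr (G *m f X)) -> psd E.
Proof.
move=> cf pG EG v.
have -> : (v ^t* *m E *m v) 0 0 = \tr (E *m (v *m v ^t* )).
  by rewrite mulmxA mxtrace_mulC mulmxA /mxtrace big_ord1.
rewrite EG; apply: (psd_mul_tr_ge0 pG); apply: (cp_positive cf).
by rewrite -{1}[v]trmxCK; exact: psd_gram.
Qed.

(** Trace preservation makes the dual map unital, so 1 - E is the dual of 1 - G. *)
Lemma cptp_dual m d (f : 'M[C]_m -> 'M[C]_d) (G : 'M[C]_d) :
  cptp f -> psd G -> psd (1%:M - G) ->
  exists E : 'M[C]_m, [/\ psd E, psd (1%:M - E) &
    forall X, \tr (E *m X) = \tr (G *m f X)].
Proof.
move=> [lf cf tf] pG pG'; have [E EE] := linear_dual G lf.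
exists E; split=> //; first exact: (psd_dual cf pG).
by apply: (psd_dual cf pG') => X; rewrite !mulmxBl !mul1mx !mxtraceB tf EE.
Qed.

(** * Measure-and-prepare channels *)

Definition measure_channel m d (E : 'M[C]_m) (i j : 'I_d) (X : 'M[C]_m) : 'M[C]_d :=
  \tr (E *m X) *: delta_mx i i + \tr ((1%:M - E) *m X) *: delta_mx j j.

Lemma measure_channel_cptp m d (E : 'M[C]_m) (i j : 'I_d) :
  psd E -> psd (1%:M - E) -> cptp (measure_channel E i j).
Proof.
move=> pE pE'; split.
- move=> a X Y; rewrite /measure_channel !mulmxDr -!scalemxAr !mxtraceD !mxtraceZ.
  by rewrite !scalerDl !scalerDr !scalerA addrACA.
- by apply: cp_add; exact: cp_measure.
- move=> X; rewrite mxtraceD !mxtraceZ !mxtrace_delta !mulr1 -mxtraceD -mulmxDl.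
  by rewrite addrC subrK mul1mx.
Qed.

(** On a traceless [X] the two outcome weights are opposite, so the output is a multiple of e_ii -
    e_jj. *)
Lemma measure_channel_trnorm m d (E X : 'M[C]_m) (i j : 'I_d) :
  i != j -> \tr X = 0 -> 0 <= \tr (E *m X) ->
  trnorm (measure_channel E i j X) = \tr (E *m X) *+ 2.
Proof.
move=> ij tX tEX; rewrite -(trnorm_delta_sub ij tEX) /measure_channel; congr trnorm.
by rewrite mulmxBl mul1mx mxtraceB tX sub0r scaleNr scalerBr.
Qed.

End Channels.

(** * From a channel to an effect and back *)

Theorem theorem1 (R : realType) (m d : nat) (A B Pp Pm : 'M[R[i]]_m) :
  (1 <= m)%N -> (2 <= d)%N ->
  herm A -> herm B -> \tr A = 0 -> \tr B = 0 ->
  orth_proj_onto Pp (pos_eigvec (A - B)) ->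
  orth_proj_onto Pm (neg_eigvec (A - B)) ->
  let P0 := 1%:M - Pp - Pm in
  (exists lam : 'M[R[i]]_m -> 'M[R[i]]_d,
      cptp lam /\
      trnorm (lam A) - trnorm (lam B) = trnorm (lam (A - B)) /\
      trnorm (lam (A - B)) = trnorm (A - B))
  <->
  (exists E0 : 'M[R[i]]_m,
      loewner_le 0 E0 /\ loewner_le E0 P0 /\
      \tr (Pp *m B) + \tr (E0 *m B) <= \tr (Pp *m A) + \tr (E0 *m A) /\
      0 <= \tr (Pp *m B) + \tr (E0 *m B)).
Proof.
move=> _ d2 hA hB tA tB oPp oPm P0.
have hD : herm (A - B) by exact: herm_sub.
have tD : \tr (A - B) = 0 by rewrite mxtraceB tA tB subrr.
have [jP [Y PpY] [Z PmZ] PmPp P0D] := signed_projectors hD oPp oPm.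
have [PpPp hPp _ pDp pDm] := jP; have [PmPm hPm _] := oPm.
have nD := trnorm_traceless hD tD jP.
have trD : 0 <= \tr (Pp *m (A - B)) by exact: psd_tr_ge0.
split=> [[lam [cptp_lam [nAB nlD]]]|[E0 [pE0 [pPE0 [_ trB]]]]].
  have [lin cp tp] := cptp_lam.
  have lamB : lam (A - B) = lam A - lam B.
    by rewrite addrC -scaleN1r lin scaleN1r addrC.
  rewrite lamB in nAB nlD.
  have [||||Q [pQ pQ' nQ trQB]] := trnorm_split_effect _ _ _ _ nAB;
    rewrite ?tp //; try exact: positive_herm.
  (* The dual of [lam] pulls [Q] back to an effect on the input space that is again optimal for A -
     B. *)
  have [E [pE pE' EE]] := cptp_dual cptp_lam pQ pQ'.
  have eqE : \tr (E *m (A - B)) = \tr (Pp *m (A - B)).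
    by apply: (@pmulrnI _ 2) => //; rewrite EE lamB nQ nlD nD.
  have [EDp EDm] := tr_jordan_eq jP pE pE' eqE.
  (* [Pp] factors through the positive part of A - B, which [E] fixes; [Pm] factors through the
     negative part, which [E] kills. *)
  have EPp : E *m Pp = Pp.
    apply/eqP; rewrite eq_sym -subr_eq0 -[X in X - _]mul1mx -mulmxBl.
    by rewrite PpY mulmxA EDp mul0mx.
  have EPm : E *m Pm = 0 by rewrite PmZ mulmxA EDm mul0mx.
  have hE := psd_herm pE.
  have PpE : Pp *m E = Pp by rewrite -hPp -hE -adjmx_mul EPp.
  have PmE : Pm *m E = 0.
    by rewrite -hPm -hE -adjmx_mul EPm trmx0 map_mx0.
  exists (E - Pp); rewrite /loewner_le; split; [|split; [|split]].
  (* As [E] fixes the range of [Pp], E - Pp is the compression of [E] to the complement of that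
     range. *)
  - have -> : E - Pp - 0 = (1%:M - Pp) *m E *m (1%:M - Pp).
      rewrite mulmxBl mul1mx PpE mulmxBr mulmx1 mulmxBl EPp.
      by rewrite PpPp subrr !subr0.
    by apply: psd_herm_congr => //; apply: herm_sub => //; exact: adjmx1.
  (* Dually, 1 - Pm - E is the compression of 1 - E to the complement of the range of [Pm]. *)
  - have -> : P0 - (E - Pp) = (1%:M - Pm) *m (1%:M - E) *m (1%:M - Pm).
      rewrite mulmxBl mul1mx (mulmxBr Pm) mulmx1 PmE subr0.
      rewrite mulmxBr mulmx1 !mulmxBl !mul1mx EPm PmPm subr0 subrr subr0 /P0.
      by rewrite opprB addrA [RHS]addrAC; congr (_ - _); rewrite addrAC subrK.
    by apply: psd_herm_congr => //; apply: herm_sub => //; exact: adjmx1.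
  (* The two sides differ by Tr(E(A - B)) = Tr(Pp(A - B)) >= 0. *)
  - rewrite !mulmxBl !mxtraceB ![\tr (Pp *m _) + _]addrC !subrK.
    by rewrite -subr_ge0 -mxtraceB -mulmxBr eqE.
  - by rewrite mulmxBl mxtraceB addrC subrK EE.
rewrite /loewner_le subr0 in pE0 pPE0.
(* Conversely, Pp + E0 is an effect: its complement is the sum of the positive matrices P0 - E0 and
   Pm. *)
have pE : psd (Pp + E0) by exact: psdD (psd_proj PpPp hPp) pE0.
have pE' : psd (1%:M - (Pp + E0)).
  have -> : 1%:M - (Pp + E0) = (P0 - E0) + Pm.
    by rewrite /P0 opprD addrA [RHS]addrAC subrK.
  exact: psdD pPE0 (psd_proj PmPm hPm).
(* [P0] kills the positive and negative parts of A - B; since 0 <= E0 <= P0, so does [E0]. *)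
have P0Pp : P0 *m (Pp *m (A - B)) = 0.
  have P0P : P0 *m Pp = 0 by rewrite !mulmxBl mul1mx PpPp PmPp subrr subr0.
  by rewrite mulmxA P0P mul0mx.
have P0Pm : P0 *m ((Pp - 1%:M) *m (A - B)) = 0.
  by rewrite (mulmxBl Pp) mul1mx (mulmxBr P0) P0Pp P0D subrr.
have E0D : E0 *m (A - B) = 0.
  have -> : A - B = Pp *m (A - B) - (Pp - 1%:M) *m (A - B).
    by rewrite -mulmxBl opprB [Pp + _]addrC subrK mul1mx.
  rewrite mulmxBr (psd_mul_eq0_le pE0 pPE0 pDp P0Pp).
  by rewrite (psd_mul_eq0_le pE0 pPE0 pDm P0Pm) subrr.
have trED : \tr ((Pp + E0) *m (A - B)) = \tr (Pp *m (A - B)).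
  by rewrite mulmxDl E0D addr0.
have trEB : 0 <= \tr ((Pp + E0) *m B) by rewrite mulmxDl mxtraceD.
have trEA : 0 <= \tr ((Pp + E0) *m A).
  by rewrite -[A](subrK B) mulmxDr mxtraceD trED addr_ge0.
(* The bound d >= 2 supplies two distinct basis vectors. *)
pose i0 : 'I_d := Ordinal (ltnW d2); pose i1 : 'I_d := Ordinal d2.
exists (measure_channel (Pp + E0) i0 i1); split; first exact: measure_channel_cptp.
rewrite !measure_channel_trnorm ?trED // nD; split=> //.
by rewrite -mulrnBl -mxtraceB -mulmxBr trED.
Qed.
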